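(* Let $K$ be a differential field of characteristic $0$, let $a\in K$, and let $u$ be an element of a differential extension of $K$ satisfying the equation $y'-ay=0$. Suppose that $K(u)$ has the same field of constants as $K$. Then $K(u)$ is a Picard-Vessiot extension of $K$, and its differential Galois group is isomorphic to a subgroup of the multiplicative group of nonzero constants of $K$.
   Context: A differential field is a field with one derivation $y\mapsto y'$; its constants are the elements of derivative zero. For elements $u_1,\dots,u_n$ of a differential extension of $K$, $K(u_1,\dots,u_n)$ denotes the differential subfield generated by $K$ and $u_1,\dots,u_n$. Elements $u_1,\dots,u_n$ that are solutions of a homogeneous linear differential equation of order $n$ over $K$ form a fundamental system of solutions if their wronskian $\det(u_i^{(j-1)})_{1\le i,j\le n}$ is nonzero. A differential extension $M\supseteq K$ is a Picard-Vessiot extension of $K$ if $M=K(u_1,\dots,u_n)$ for a fundamental system of solutions $(u_1,\dots,u_n)$ of some homogeneous linear differential equation over $K$ and $M$ has the same field of constants as $K$. The differential Galois group of $M/K$ is the group of all differential field automorphisms of $M$ fixing $K$ elementwise. *)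

(* Defs.v *)
From HB Require Import structures.
From mathcomp Require Import all_boot all_order all_algebra.
From mathcomp Require Import boolp.
Set Implicit Arguments.
Unset Strict Implicit.
Unset Printing Implicit Defensive.
Import GRing.Theory.
Local Open Scope ring_scope.

HB.mixin Record Field_isDifferential K of GRing.Field K := {
  der : K -> K;
  derD : {morph der : x y / x + y};
  derM : forall x y : K, der (x * y) = der x * y + x * der y
}.
#[short(type="diffFieldType")]
HB.structure Definition DiffField :=
  { K of Field_isDifferential K & GRing.Field K }.

(* A differential extension of K is a differential field L together with a
   differential morphism K -> L, which is automatically injective. *)
HB.mixin Record isDiffMorphism (K L : diffFieldType) (f : K -> L) := {
  diff_morphE : {morph f : x / der x}
}.
HB.structure Definition DiffMorphism (K L : diffFieldType) :=
  { f of isDiffMorphism K L f & @GRing.RMorphism K L f }.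
Notation "{ 'diffmorphism' K -> L }" := (DiffMorphism.type K%type L%type)
  (at level 0, K at level 98, L at level 99,
   format "{ 'diffmorphism'  K  ->  L }") : type_scope.

Section DiffFieldTheory.
Variable K : diffFieldType.
Implicit Types x y : K.

Lemma der0 : der (0 : K) = 0.
Proof. by apply: (addrI (der 0)); rewrite -derD !addr0. Qed.

Lemma der1 : der (1 : K) = 0.
Proof.
by apply: (addrI (der 1)); rewrite addr0 -[in RHS](mulr1 1) derM mulr1 mul1r.
Qed.

Lemma derN x : der (- x) = - der x.
Proof. by apply: (addrI (der x)); rewrite -derD !subrr der0. Qed.

Lemma derV x : der x^-1 = - der x / (x * x).
Proof.
have [->|x0] := eqVneq x 0; first by rewrite invr0 der0 oppr0 mul0r.
have : der (x * x^-1) = 0 by rewrite mulfV // der1.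
rewrite derM => /eqP; rewrite addrC addr_eq0 => /eqP h.
by apply: (mulfI x0); rewrite h invfM -mulNr [RHS]mulrCA mulVKf.
Qed.
End DiffFieldTheory.

Definition diff_subfield (L : diffFieldType) (S : {pred L}) : Prop :=
  divring_closed S /\ {in S, forall x, der x \in S}.

(* K(us): the intersection of all differential subfields of L that contain
   the image of K and the elements of us. *)
Definition adjoin (K L : diffFieldType) (i : {diffmorphism K -> L})
    (us : seq L) : {pred L} :=
  fun x => `[< forall S : {pred L}, diff_subfield S ->
                 (forall k, i k \in S) -> {subset us <= S} -> x \in S >].

Section Adjoin.
Variables (K L : diffFieldType) (i : {diffmorphism K -> L}) (us : seq L).
Local Notation A := (adjoin i us).

Lemma adjoinP x :
  reflect (forall S : {pred L}, diff_subfield S ->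
             (forall k, i k \in S) -> {subset us <= S} -> x \in S) (x \in A).
Proof. exact: asboolP. Qed.

Lemma adjoin_divring_closed : divring_closed A.
Proof.
split=> [|x y /adjoinP Ax /adjoinP Ay|x y /adjoinP Ax /adjoinP Ay];
  apply/adjoinP => S dS iS uS; have [[S1 SB SV] _] := dS => //.
- by apply: SB; [apply: Ax|apply: Ay].
- by apply: SV; [apply: Ax|apply: Ay].
Qed.

Lemma adjoin_der : {in A, forall x, der x \in A}.
Proof.
move=> x /adjoinP Ax; apply/adjoinP => S dS iS uS.
by case: (dS) => _; apply; apply: Ax.
Qed.

Lemma adjoin_base k : i k \in A.
Proof. by apply/adjoinP => S _ iS _; apply: iS. Qed.

Lemma adjoin_gen : {subset us <= A}.
Proof. by move=> x xu; apply/adjoinP => S _ _; apply. Qed.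

HB.instance Definition _ :=
  GRing.isDivringClosed.Build L A adjoin_divring_closed.

Record adjoin_field := AdjoinField { adjoin_val : L; _ : adjoin_val \in A }.

HB.instance Definition _ := [isSub for adjoin_val].
HB.instance Definition _ := [Choice of adjoin_field by <:].
HB.instance Definition _ := [SubChoice_isSubIntegralDomain of adjoin_field by <:].
HB.instance Definition _ := [SubIntegralDomain_isSubField of adjoin_field by <:].

Definition adjoin_diff (x : adjoin_field) : adjoin_field :=
  AdjoinField (adjoin_der (valP x)).

Fact adjoin_diffD : {morph adjoin_diff : x y / x + y}.
Proof. by move=> x y; apply: val_inj; rewrite /= derD. Qed.

Fact adjoin_diffM x y :
  adjoin_diff (x * y) = adjoin_diff x * y + x * adjoin_diff y.
Proof. by apply: val_inj; rewrite /= derM. Qed.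

HB.instance Definition _ :=
  Field_isDifferential.Build adjoin_field adjoin_diffD adjoin_diffM.

Definition adjoin_embed (k : K) : adjoin_field := AdjoinField (adjoin_base k).

Fact adjoin_embed_zmod_morphism : zmod_morphism adjoin_embed.
Proof. by move=> x y; apply: val_inj; rewrite /= rmorphB. Qed.

Fact adjoin_embed_monoid_morphism : monoid_morphism adjoin_embed.
Proof. by split=> [|x y]; apply: val_inj; rewrite /= ?rmorph1 ?rmorphM. Qed.

Fact adjoin_embed_der : {morph adjoin_embed : x / der x}.
Proof. by move=> x; apply: val_inj; rewrite /= diff_morphE. Qed.

HB.instance Definition _ := GRing.isZmodMorphism.Build K adjoin_field
  adjoin_embed adjoin_embed_zmod_morphism.
HB.instance Definition _ := GRing.isMonoidMorphism.Build K adjoin_field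
  adjoin_embed adjoin_embed_monoid_morphism.
HB.instance Definition _ := isDiffMorphism.Build K adjoin_field
  adjoin_embed adjoin_embed_der.
End Adjoin.
Arguments adjoin_embed {K L} i us k.

Section PicardVessiot.
Variables (K M : diffFieldType) (i : {diffmorphism K -> M}).

Definition same_constants : Prop :=
  forall c : M, der c = 0 <-> exists2 k : K, der k = 0 & i k = c.

(* c_0 y + c_1 y' + ... + c_n y^(n) = 0; this has order n when c_n != 0. *)
Definition lde_solution n (c : 'I_n.+1 -> K) (y : M) : Prop :=
  \sum_(j < n.+1) i (c j) * iter j der y = 0.

Definition wronskian n (us : n.-tuple M) : M :=
  \det (\matrix_(r < n, j < n) iter j der (tnth us r)).

Definition fundamental_system n (c : 'I_n.+1 -> K) (us : n.-tuple M) : Prop :=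
  (forall r : 'I_n, lde_solution c (tnth us r)) /\ wronskian us != 0.

Definition picard_vessiot : Prop :=
  (exists (n : nat) (c : 'I_n.+1 -> K) (us : n.-tuple M),
     [/\ (0 < n)%N, c ord_max != 0, fundamental_system c us
       & forall x : M, x \in adjoin i us])
  /\ same_constants.

Definition diff_automorphism (g : M -> M) : Prop :=
  [/\ zmod_morphism g, monoid_morphism g, bijective g,
      {morph g : x / der x} & forall k, g (i k) = i k].

Record diff_galois := DiffGalois {
  diff_galois_fun :> M -> M;
  _ : `[< diff_automorphism diff_galois_fun >] }.

HB.instance Definition _ := [isSub for diff_galois_fun].
HB.instance Definition _ := [Choice of diff_galois by <:].

Implicit Types g h : diff_galois.

Lemma diff_galoisP g : diff_automorphism g.
Proof. by apply/asboolP; exact: (valP g). Qed.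

Lemma diff_galois_eqP g h : g =1 h -> g = h.
Proof. by move=> gh; apply: val_inj; apply/funext. Qed.

Fact diff_galois_one_subproof : diff_automorphism id.
Proof. by split=> //; exists id. Qed.

Fact diff_galois_mul_subproof g h : diff_automorphism (g \o h).
Proof.
have [gB gM gb gd gK] := diff_galoisP g.
have [hB hM hb hd hK] := diff_galoisP h.
split=> [x y||||k] /=; first by rewrite hB gB.
- by split=> [|x y] /=; rewrite ?hM ?gM.
- exact: bij_comp.
- by move=> x /=; rewrite hd gd.
- by rewrite hK gK.
Qed.

Fact diff_galois_inv_ex g : exists f : M -> M, cancel g f /\ cancel f g.
Proof. by have [_ _ [f gK fK] _ _] := diff_galoisP g; exists f. Qed.

Definition diff_galois_invfun g : M -> M := projT1 (cid (diff_galois_inv_ex g)).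

Lemma diff_galois_funK g : cancel g (diff_galois_invfun g).
Proof. exact: (projT2 (cid (diff_galois_inv_ex g))).1. Qed.

Lemma diff_galois_invfunK g : cancel (diff_galois_invfun g) g.
Proof. exact: (projT2 (cid (diff_galois_inv_ex g))).2. Qed.

Fact diff_galois_inv_subproof g : diff_automorphism (diff_galois_invfun g).
Proof.
have fK := diff_galois_funK g; have gK := diff_galois_invfunK g.
have gI := can_inj fK; have [gB gM gb gd gi] := diff_galoisP g.
split=> [x y||||k].
- by apply: gI; rewrite gB !gK.
- by split=> [|x y]; apply: gI; rewrite ?gM !gK // gM.
- by exists g.
- by move=> x; apply: gI; rewrite gd !gK.
- by apply: gI; rewrite gK gi.
Qed.

Definition diff_galois_one := DiffGalois (asboolT diff_galois_one_subproof).
Definition diff_galois_mul g h :=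
  DiffGalois (asboolT (diff_galois_mul_subproof g h)).
Definition diff_galois_inv g :=
  DiffGalois (asboolT (diff_galois_inv_subproof g)).

Fact diff_galois_mulA : associative diff_galois_mul.
Proof. by move=> g h k; apply: diff_galois_eqP. Qed.
Fact diff_galois_mul1g : left_id diff_galois_one diff_galois_mul.
Proof. by move=> g; apply: diff_galois_eqP. Qed.
Fact diff_galois_mulg1 : right_id diff_galois_one diff_galois_mul.
Proof. by move=> g; apply: diff_galois_eqP. Qed.
Fact diff_galois_mulVg :
  left_inverse diff_galois_one diff_galois_inv diff_galois_mul.
Proof. by move=> g; apply: diff_galois_eqP => x /=; rewrite diff_galois_funK. Qed.
Fact diff_galois_mulgV :
  right_inverse diff_galois_one diff_galois_inv diff_galois_mul.
Proof.
by move=> g; apply: diff_galois_eqP => x /=; rewrite diff_galois_invfunK.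
Qed.

HB.instance Definition _ := isGroup.Build diff_galois diff_galois_mulA
  diff_galois_mul1g diff_galois_mulg1 diff_galois_mulVg diff_galois_mulgV.
End PicardVessiot.

Section ConstantUnits.
Variable K : diffFieldType.

Record const_unit := ConstUnit {
  const_unit_val : K;
  _ : (const_unit_val != 0) && (der const_unit_val == 0) }.

HB.instance Definition _ := [isSub for const_unit_val].
HB.instance Definition _ := [Choice of const_unit by <:].

Implicit Types c d : const_unit.

Lemma const_unit_neq0 c : val c != 0.
Proof. by case/andP: (valP c). Qed.

Lemma const_unit_der c : der (val c) = 0.
Proof. by case/andP: (valP c) => _ /eqP. Qed.

Fact const_unit_one_subproof : ((1 : K) != 0) && (der (1 : K) == 0).
Proof. by rewrite oner_eq0 der1 eqxx. Qed.

Fact const_unit_mul_subproof c d :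
  (val c * val d != 0) && (der (val c * val d) == 0).
Proof.
by rewrite mulf_neq0 ?const_unit_neq0 // derM !const_unit_der mul0r mulr0 addr0 eqxx.
Qed.

Fact const_unit_inv_subproof c : ((val c)^-1 != 0) && (der (val c)^-1 == 0).
Proof.
by rewrite invr_eq0 const_unit_neq0 derV const_unit_der oppr0 mul0r eqxx.
Qed.

Definition const_unit_one := ConstUnit const_unit_one_subproof.
Definition const_unit_mul c d := ConstUnit (const_unit_mul_subproof c d).
Definition const_unit_inv c := ConstUnit (const_unit_inv_subproof c).

Fact const_unit_mulA : associative const_unit_mul.
Proof. by move=> c d e; apply: val_inj; rewrite /= mulrA. Qed.
Fact const_unit_mul1g : left_id const_unit_one const_unit_mul.
Proof. by move=> c; apply: val_inj; rewrite /= mul1r. Qed.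
Fact const_unit_mulg1 : right_id const_unit_one const_unit_mul.
Proof. by move=> c; apply: val_inj; rewrite /= mulr1. Qed.
Fact const_unit_mulVg :
  left_inverse const_unit_one const_unit_inv const_unit_mul.
Proof. by move=> c; apply: val_inj; rewrite /= mulVf ?const_unit_neq0. Qed.
Fact const_unit_mulgV :
  right_inverse const_unit_one const_unit_inv const_unit_mul.
Proof. by move=> c; apply: val_inj; rewrite /= mulfV ?const_unit_neq0. Qed.

HB.instance Definition _ := isGroup.Build const_unit const_unit_mulA
  const_unit_mul1g const_unit_mulg1 const_unit_mulVg const_unit_mulgV.
End ConstantUnits.

Section Subgroup.
Variables (G : groupType) (H : groupClosed G).

Record subgroup_type := Subgroup { subgroup_val : G; _ : subgroup_val \in H }.

HB.instance Definition _ := [isSub for subgroup_val].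
HB.instance Definition _ := [Choice of subgroup_type by <:].

Fact subgroup_closed : group_closed H.
Proof. by split=> [|x y xH yH]; [exact: gpred1 | exact: gpredF]. Qed.

HB.instance Definition _ :=
  SubChoice_isSubGroup.Build G _ subgroup_type subgroup_closed.
End Subgroup.

Definition isomorphic (G H : groupType) : Prop :=
  exists f : {multiplicative G -> H}, bijective f.

Definition isomorphic_to_subgroup (G C : groupType) : Prop :=
  exists H : groupClosed C, isomorphic G (subgroup_type H).

(* Main.v *)
Require Import Defs.
From HB Require Import structures.
From mathcomp Require Import all_boot all_order all_algebra.
From mathcomp Require Import boolp.
Set Implicit Arguments.
Unset Strict Implicit.
Unset Printing Implicit Defensive.
Import GRing.Theory.
Local Open Scope ring_scope.

(** If w != 0 and w' = b w, then any differential K-automorphism g maps w to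
    another solution of y' = b y, so g w / w is a constant, hence lies in K.
    This makes g |-> g w / w a homomorphism to the nonzero constants of K; it is
    injective because w generates the extension. For u != 0 take w = u and
    b = a. For u = 0 the extension is trivial, u is not a fundamental system, and
    one takes w = 1 and b = 0 instead. *)

Section InjectiveMorphism.
Variables (G C : groupType) (f : UMagmaMorphism.type G C).

Definition group_image : {pred C} := fun x => `[< exists g, f g = x >].

Lemma group_imageP x : reflect (exists g, f g = x) (x \in group_image).
Proof. exact: asboolP. Qed.

Lemma mem_group_image g : f g \in group_image.
Proof. by apply/group_imageP; exists g. Qed.

Fact group_image_mulg_closed : mulg_closed group_image.
Proof.
move=> _ _ /group_imageP[g <-] /group_imageP[h <-].
by rewrite -gmulfM mem_group_image.
Qed.

Fact group_image1 : 1%g \in group_image.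
Proof. by apply/group_imageP; exists 1%g; rewrite gmulf1. Qed.

Fact group_image_invg_closed : invg_closed group_image.
Proof. by move=> _ /group_imageP[g <-]; rewrite -gmulfV mem_group_image. Qed.

HB.instance Definition _ := isMulClosed.Build C group_image
  group_image_mulg_closed.
HB.instance Definition _ := isMul1Closed.Build C group_image group_image1.
HB.instance Definition _ := isInvClosed.Build C group_image
  group_image_invg_closed.

Definition to_group_image (g : G) : subgroup_type group_image :=
  Subgroup (mem_group_image g).

Fact to_group_imageM : {morph to_group_image : g h / (g * h)%g}.
Proof. by move=> g h; apply: val_inj; rewrite /= gmulfM. Qed.

HB.instance Definition _ := isMultiplicative.Build G (subgroup_type group_image)
  to_group_image to_group_imageM.

(** The subgroup is the image of [f]. Injectivity makes any chosen preimage a two-sided inverse of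
    the corestriction [to_group_image]. *)
Lemma injective_isomorphic_to_subgroup :
  injective f -> isomorphic_to_subgroup G C.
Proof.
move=> f_inj; exists (GroupClosed.clone C group_image _), to_group_image.
have surj (x : subgroup_type group_image) : exists g, f g = val x.
  exact/group_imageP/valP.
exists (fun x => projT1 (cid (surj x))) => [g|x].
  by apply: f_inj; case: cid.
by apply: val_inj; case: cid.
Qed.
End InjectiveMorphism.

Section DiffGaloisMorphism.
Variables (K M : diffFieldType) (i : {diffmorphism K -> M}).
Implicit Types g h : diff_galois i.

Fact diff_galois_zmod_morphism g : zmod_morphism g.
Proof. by case: (diff_galoisP g). Qed.

Fact diff_galois_monoid_morphism g : monoid_morphism g.
Proof. by case: (diff_galoisP g). Qed.

Lemma diff_galois_der g : {morph g : x / der x}.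
Proof. by case: (diff_galoisP g). Qed.

Lemma diff_galois_base g k : g (i k) = i k.
Proof. by case: (diff_galoisP g). Qed.

HB.instance Definition _ g := GRing.isZmodMorphism.Build M M
  (diff_galois_fun g) (diff_galois_zmod_morphism g).
HB.instance Definition _ g := GRing.isMonoidMorphism.Build M M
  (diff_galois_fun g) (diff_galois_monoid_morphism g).

(* The equalizer of two automorphisms is a differential subfield. *)
Lemma diff_galois_eq_on_gen us g h :
  (forall x, x \in adjoin i us) -> {in us, g =1 h} -> g = h.
Proof.
move=> us_gen gh; apply: diff_galois_eqP => x.
suff /eqP : x \in [pred y | g y == h y] by [].
have /adjoinP := us_gen x; apply=> [|k|y /gh gh_y]; rewrite ?inE.
- split; last by move=> y; rewrite !inE !diff_galois_der => /eqP->.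
  split=> [|y z|y z]; rewrite !inE.
  + by rewrite !rmorph1.
  + by rewrite !rmorphB /= => /eqP-> /eqP->.
  + by rewrite !fmorph_div /= => /eqP-> /eqP->.
- by rewrite !diff_galois_base.
- exact/eqP.
Qed.
End DiffGaloisMorphism.

Section ExponentialExtension.
Variables (K M : diffFieldType) (i : {diffmorphism K -> M}) (b : K) (w : M).
Hypotheses (w_neq0 : w != 0) (der_w : der w = i b * w).
Hypothesis w_gen : forall x : M, x \in adjoin i [:: w].
Hypothesis sameC : same_constants i.

Lemma exponential_picard_vessiot : picard_vessiot i.
Proof.
(* The equation is [- b y + y' = 0], of order 1 with leading coefficient 1; the wronskian of the
   single solution [w] is [w] itself. *)
split=> //; exists 1%N, (fun j => if j == ord0 then - b else 1), [tuple w].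
split=> //; first by rewrite oner_eq0.
split; last by rewrite /wronskian det_mx11 mxE.
move=> r; rewrite ord1 /lde_solution !big_ord_recl big_ord0 /= addr0.
by rewrite (tnth_nth 0) /= rmorphN rmorph1 mul1r mulNr der_w addNr.
Qed.

(** By the quotient rule [v / w] has derivative zero, and [sameC] brings this constant of [M] down
    to [K]. *)
Lemma constant_ratio (v : M) :
  der v = i b * v -> exists2 k : K, der k = 0 & i k * w = v.
Proof.
move=> der_v; have /sameC[k k0 ik] : der (v / w) = 0.
  rewrite derM derV der_v der_w invfM mulNr mulrN -mulrA; apply/eqP.
  by rewrite subr_eq0 [i b * w * _]mulrA mulfK // mulrCA.
by exists k; rewrite // ik divfK.
Qed.

Lemma galois_multiplier_ex (g : diff_galois i) :
  exists c : const_unit K, i (val c) * w = g w.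
Proof.
have [|k k0 kw] := @constant_ratio (g w).
  by rewrite -diff_galois_der der_w rmorphM /= diff_galois_base.
have k_neq0 : k != 0.
  (* A zero multiplier would give [g w = 0], hence [w = 0] since a field morphism is injective. *)
  apply: contra_neq w_neq0 => k_eq0; apply: (fmorph_inj g).
  by rewrite /= -kw k_eq0 !rmorph0 mul0r.
have kP : (k != 0) && (der k == 0) by rewrite k_neq0 k0 eqxx.
by exists (ConstUnit kP).
Qed.

(** The chosen constant is in fact unique, because [w != 0] and [i] is injective. *)
Definition galois_multiplier (g : diff_galois i) : const_unit K :=
  projT1 (cid (galois_multiplier_ex g)).

Lemma galois_multiplierE g : i (val (galois_multiplier g)) * w = g w.
Proof. by rewrite /galois_multiplier; case: cid. Qed.

(** Write [c_g] for the multiplier of [g]. Since [g] fixes the image of [K], [g (h w) = g (c_h w) =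
    c_h (g w) = c_h c_g w], and the two factors commute. *)
Fact galois_multiplierM : {morph galois_multiplier : g h / (g * h)%g}.
Proof.
move=> g h; apply/val_inj/(fmorph_inj i)/(mulIf w_neq0).
rewrite galois_multiplierE /= -galois_multiplierE.
by rewrite rmorphM /= diff_galois_base -galois_multiplierE rmorphM mulrA [i _ * i _]mulrC.
Qed.

Fact galois_multiplier1 : galois_multiplier 1%g = 1%g.
Proof.
apply/val_inj/(fmorph_inj i)/(mulIf w_neq0).
by rewrite galois_multiplierE /= rmorph1 mul1r.
Qed.

HB.instance Definition _ := isMultiplicative.Build (diff_galois i)
  (const_unit K) galois_multiplier galois_multiplierM.
HB.instance Definition _ := Multiplicative_isUMagmaMorphism.Build
  (diff_galois i) (const_unit K) galois_multiplier galois_multiplier1.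

(** Equal multipliers give equal values at [w], and an automorphism is determined by its value at
    the generator [w]. *)
Lemma exponential_galois :
  isomorphic_to_subgroup (diff_galois i) (const_unit K).
Proof.
apply: (@injective_isomorphic_to_subgroup _ _ galois_multiplier) => g h gh.
apply: (diff_galois_eq_on_gen w_gen) => x; rewrite inE => /eqP->.
by rewrite -!galois_multiplierE gh.
Qed.
End ExponentialExtension.

(* K(us) need not be all of L; regarded as an extension of K in its own right,
   it is still generated by any vs that generates us. *)
Lemma adjoin_embed_generated (K L : diffFieldType) (i : {diffmorphism K -> L})
    (us : seq L) (vs : seq (adjoin_field i us)) :
  (forall S : {pred L}, diff_subfield S -> {subset map val vs <= S} ->
     {subset us <= S}) ->
  forall x, x \in adjoin (adjoin_embed i us) vs.
Proof.
move=> gen x; apply/adjoinP => S [[S1 SB SV] Sd] iS vS.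
(* [T] is the image of [S] in [L]. It is a differential subfield containing [K] and [us], so it
   contains all of [K(us)]; injectivity of [val] then brings membership back to [S]. *)
pose T : {pred L} := fun y => `[< exists2 z, z \in S & val z = y >].
have TP y : reflect (exists2 z, z \in S & val z = y) (y \in T).
  exact: asboolP.
have dT : diff_subfield T.
  split; last by move=> _ /TP[y yS <-]; apply/TP; exists (der y); first exact: Sd.
  split=> [|_ _ /TP[y yS <-] /TP[z zS <-]|_ _ /TP[y yS <-] /TP[z zS <-]];
    apply/TP.
  - by exists 1.
  - by exists (y - z); first exact: SB.
  - by exists (y / z); first exact: SV.
have /TP[y yS /val_inj <- //] : val x \in T.
have /adjoinP := valP x; apply=> // [k|].
  by apply/TP; exists (adjoin_embed i us k); first exact: iS.
by apply: gen => // _ /mapP[v /vS vS' ->]; apply/TP; exists v.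
Qed.

Theorem mainTheorem8 (K L : diffFieldType) (i : {diffmorphism K -> L})
    (a : K) (u : L) :
  [pchar K] =i pred0 ->
  der u - i a * u = 0 ->
  same_constants (adjoin_embed i [:: u]) ->
  picard_vessiot (adjoin_embed i [:: u]) /\
  isomorphic_to_subgroup (diff_galois (adjoin_embed i [:: u]))
    (const_unit K).
Proof.
move=> _ /subr0_eq der_u sameC.
suff [b [w [w0 der_w w_gen]]] : exists b w, [/\ w != 0,
    der w = adjoin_embed i [:: u] b * w
  & forall x, x \in adjoin (adjoin_embed i [:: u]) [:: w]].
  split; first exact: (exponential_picard_vessiot w0 der_w w_gen sameC).
  exact: (exponential_galois w0 der_w w_gen sameC).
have [u0|u_neq0] := eqVneq u 0.
  exists 0, 1; split; first exact: oner_neq0.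
    by rewrite der1 rmorph0 mul0r.
  (* The generator [u = 0] lies in every subfield, as [1 - 1]. *)
  apply: adjoin_embed_generated => S [[S1 SB _] _] _ y.
  by rewrite inE u0 => /eqP->; rewrite -(subrr 1) SB.
(* Here [w] is [u] itself, viewed as an element of [K(u)]. *)
exists a, (AdjoinField (@adjoin_gen K L i [:: u] u (mem_head u [::]))); split.
- by rewrite -(inj_eq val_inj).
- exact: val_inj.
- by apply: adjoin_embed_generated => S _.
Qed.
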